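(* Let $\Sigma$ be a finite alphabet with $|\Sigma|\ge 3$, and let $(p,R)$ and $(p',R')$ be relational patterns over $\Sigma$. If $\mathcal{S}_{\varepsilon,1}(p,R)\subseteq\varepsilon L_{len}(p',R')$ and $\mathcal{S}_{\varepsilon,1}(p',R')\subseteq\varepsilon L_{len}(p,R)$, then $\varepsilon L_{len}(p,R)=\varepsilon L_{len}(p',R')$. In particular, $\mathcal{S}_{\varepsilon,1}(p,R)$ is a positive characteristic set for $\varepsilon L_{len}(p,R)$ with respect to the class $\varepsilon\mathcal{L}_{len}$, i.e., assigning to each relational pattern $(p,R)$ the set $\mathcal{S}_{\varepsilon,1}(p,R)\times\{1\}$ yields a family of positive characteristic sets for the family $(\varepsilon L_{len}(p,R))_{(p,R)}$.
   Context: Let $X=\{x_1,x_2,\ldots\}$ be a countably infinite set of variables disjoint from $\Sigma$. A pattern is a finite non-empty string $p$ over $\Sigma\cup X$ in which no element of $X$ occurs more than once; $\mathit{Var}(p)$ is its set of variables. A relational pattern is a pair $(p,R)$ with $p$ a pattern and $R$ a binary relation over $X$. A substitution is a mapping $\varphi:(\Sigma\cup X)^+\to\Sigma^*$ that is a morphism with respect to concatenation and is the identity on $\Sigma^+$. It is an $R$-substitution (equal-length relation) if $(x,y)\in R$ implies $|\varphi(x)|=|\varphi(y)|$; variables may be replaced by the empty word $\varepsilon$. Define $\varepsilon L_{len}(p,R)=\{\varphi(p)\mid\varphi\text{ is an }R\text{-substitution}\}$ and let $\varepsilon\mathcal{L}_{len}$ be the class of all such languages over $\Sigma$. A group in $(p,R)$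 is a maximal set of variables in $p$ that are pairwise related via the transitive closure of the symmetric closure of $R$ over $\mathit{Var}(p)$ (a variable related to no other variable forms a group of size 1); $[x]$ denotes the group of $x\in\mathit{Var}(p)$. For an integer $\ell\ge 1$, $\mathcal{S}_{\varepsilon,\ell}(p,R)=\{\varphi(p)\mid\exists x\in\mathit{Var}(p)\ \exists z\le\ell\ [\forall y\in[x]\ |\varphi(y)|=z\ \wedge\ \forall y\notin[x]\ \varphi(y)=\varepsilon]\}$, where $\varphi$ ranges over substitutions. A set $S\subseteq\Sigma^*\times\{0,1\}$ is consistent with a language $L\subseteq\Sigma^*$ iff $(s,1)\in S$ implies $s\in L$ and $(s,0)\in S$ implies $s\notin L$. For a (countable) family of languages $(L_i)_i$, a family $(C_i)_i$ of finite subsets of $\Sigma^*\times\{1\}$ is a family of positive characteristic sets iff: (1) $C_i$ is consistent with $L_i$ for all $i$; (2) if $L_i\neq L_j$ and $C_i$ is consistent with $L_j$, then $C_j$ is not consistent with $L_i$.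
   Formalization: For a pattern p without variables, S_{ε,ℓ}(p,R) is taken to be {p} instead of the empty set (else p=a, p'=b refute the claim); groups use the closure of R over all of X, then restricted to Var(p). *)

(* Defs.v *)
From mathcomp Require Import all_boot.
From mathcomp Require Import boolp classical_sets cardinality.
From Stdlib Require Import Relation_Operators.

Set Implicit Arguments.
Unset Strict Implicit.
Unset Printing Implicit Defensive.

Local Open Scope classical_set_scope.

Section RelationalPatterns.
Variable Sigma : finType.

(* A symbol of Sigma + nat is a letter [inl a] or a variable [inr x]; the
   variable x_(i+1) is represented by the natural number i. *)
Definition symbol := (Sigma + nat)%type.

Definition variables (p : seq symbol) : seq nat :=
  pmap (fun s : symbol => if s is inr x then Some x else None) p.

Record relational_pattern := RelationalPattern {
  pattern : seq symbol;
  relation : nat -> nat -> Prop;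
  pattern_nonempty : pattern <> [::];
  pattern_uniq : uniq (variables pattern) }.

(* A morphism (Sigma + X)^+ -> Sigma^* that is the identity on Sigma^+ is the
   same thing as an arbitrary choice of the images of the variables, extended
   by [subst]. *)
Definition substitution := nat -> seq Sigma.

Definition subst (phi : substitution) (p : seq symbol) : seq Sigma :=
  flatten [seq match s with inl a => [:: a] | inr x => phi x end | s <- p].

Definition R_substitution (R : nat -> nat -> Prop) (phi : substitution) : Prop :=
  forall x y, R x y -> size (phi x) = size (phi y).

Definition epsL_len (P : relational_pattern) : set (seq Sigma) :=
  [set w | exists2 phi, R_substitution (relation P) phi
                      & w = subst phi (pattern P)].

(* The group [x]. Closures are taken of R as a relation on all of X, and then
   restricted to Var(p): since R-substitutions have to respect every pair of
   R, a chain of R-related variables leaving Var(p) also forces equal lengths.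
   If R only relates variables of p, the order of the operations is
   irrelevant. *)
Definition group (P : relational_pattern) (x : nat) : set nat :=
  [set y | y \in variables (pattern P) /\
           (y = x \/
            clos_trans nat (fun u v => relation P u v \/ relation P v u) x y)].

(* For a pattern without variables no x in Var(p) exists; the convention is
   that the set is then {p} (= the language), rather than empty. With the
   empty set, two distinct variable-free patterns would be indistinguishable.
   For patterns with variables the first disjunct is void. *)
Definition S_eps (l : nat) (P : relational_pattern) : set (seq Sigma) :=
  [set w | exists2 phi : substitution,
     variables (pattern P) = [::] \/
     (exists2 x, x \in variables (pattern P) &
      exists2 z, z <= l &
        (forall y, group P x y -> size (phi y) = z) /\
        (forall y, ~ group P x y -> phi y = [::]))
     & w = subst phi (pattern P)].

Definition consistent (S : set (seq Sigma * bool)) (L : set (seq Sigma)) : Prop :=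
  (forall s, S (s, true) -> L s) /\ (forall s, S (s, false) -> ~ L s).

Definition positive_characteristic_sets (I : Type)
    (L : I -> set (seq Sigma)) (C : I -> set (seq Sigma * bool)) : Prop :=
  [/\ forall i, finite_set (C i) /\ C i `<=` [set: seq Sigma] `*` [set true],
      forall i, consistent (C i) (L i)
    & forall i j, L i <> L j -> consistent (C i) (L j) ->
        ~ consistent (C j) (L i)].

End RelationalPatterns.

(* Main.v *)
Require Import Defs.
From mathcomp Require Import all_boot.
From mathcomp Require Import boolp classical_sets cardinality.
From mathcomp Require Import zify.
From Stdlib Require Import Relation_Operators.

Set Implicit Arguments.
Unset Strict Implicit.
Unset Printing Implicit Defensive.

Local Open Scope classical_set_scope.

(** Let [w] be the word of terminals of [p]. The language of [(p, R)] consists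
    of the words [u_0 w_1 u_1 ... w_m u_m] whose vector of gap lengths
    [(|u_0|, ..., |u_m|)] lies in the submonoid of [nat^(m+1)] generated by the
    vectors of the groups, a group contributing to each gap the number of its
    variables there. The shortest words show that both patterns have the same
    [w]. Put into every gap, for a given group, copies of a letter different
    from both neighbouring terminals (three letters suffice): the resulting
    word contains [w] as a subsequence in only one way, so its membership in
    the other language puts the vector of the group in the other submonoid. *)

(** * Gap vectors and the words that realise them *)

Definition terminals (Sigma : finType) (p : seq (symbol Sigma)) : seq Sigma :=
  pmap (fun s : symbol Sigma => if s is inl a then Some a else None) p.

Fixpoint gap (Sigma : finType) (l : nat -> nat) (p : seq (symbol Sigma))
    (i : nat) : nat :=
  match p with
  | [::] => 0
  | inl _ :: p' => if i is j.+1 then gap l p' j else 0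
  | inr x :: p' => (if i is 0 then l x else 0) + gap l p' i
  end.

(** Only [g 0], ..., [g (size w)] matter, so a gap vector can be a function on all of [nat]. *)
Fixpoint fits (Sigma : finType) (w : seq Sigma) (g : nat -> nat)
    (s : seq Sigma) : Prop :=
  if w is a :: w' then
    exists u t, [/\ size u = g 0, s = u ++ a :: t & fits w' (fun i => g i.+1) t]
  else size s = g 0.

Lemma eq_in_gap (Sigma : finType) (l l' : nat -> nat) (p : seq (symbol Sigma)) :
  {in variables p, l =1 l'} -> gap l p =1 gap l' p.
Proof.
elim: p => [//|[a|x] p IH] /= h i; first by case: i => // i; exact: IH.
congr (_ + _); last by apply: IH => y yp; apply: h; rewrite inE yp orbT.
by case: i => //; apply: h; rewrite inE eqxx.
Qed.

Lemma gapD (Sigma : finType) (l l' : nat -> nat) (p : seq (symbol Sigma)) i :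
  gap (fun x => l x + l' x) p i = gap l p i + gap l' p i.
Proof.
elim: p i => [//|[a|x] p IH] /= i; first by case: i.
by rewrite IH; case: i => [|i]; lia.
Qed.

Lemma gap0 (Sigma : finType) (p : seq (symbol Sigma)) i :
  gap (fun=> 0) p i = 0.
Proof. by elim: p i => [//|[a|x] p IH] /= [|i]; rewrite ?IH. Qed.

Lemma gap_default (Sigma : finType) (l : nat -> nat) (p : seq (symbol Sigma)) i :
  size (terminals p) < i -> gap l p i = 0.
Proof.
elim: p i => [//|[a|x] p IH] /= [|i] // h; first exact: IH.
by rewrite IH.
Qed.

Lemma eq_fits (Sigma : finType) (w : seq Sigma) (g g' : nat -> nat) s :
  g =1 g' -> fits w g s -> fits w g' s.
Proof.
elim: w g g' s => [|a w IH] g g' s e /=; first by rewrite e.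
case=> u [t] [su -> h]; exists u, t; split => //; first by rewrite su.
by apply: IH h => i.
Qed.

Lemma fits_cat (Sigma : finType) (w : seq Sigma) (g g' : nat -> nat) t s :
  g' 0 = size t + g 0 -> (forall i, g' i.+1 = g i.+1) ->
  fits w g s -> fits w g' (t ++ s).
Proof.
case: w => [|a w] /= e0 eS; first by rewrite size_cat e0 => ->.
case=> u [v] [su -> h]; exists (t ++ u), v; split.
- by rewrite size_cat su e0.
- by rewrite catA.
- by apply: eq_fits h => i.
Qed.

Lemma fits_drop (Sigma : finType) (w : seq Sigma) (g g' : nat -> nat) n s :
  g' 0 = n + g 0 -> (forall i, g' i.+1 = g i.+1) ->
  fits w g' s -> size (take n s) = n /\ fits w g (drop n s).
Proof.
case: w => [|a w] /= e0 eS.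
  by move=> h; rewrite size_take_min size_drop; split; lia.
case=> u [v] [su -> h].
have nu : n <= size u by lia.
split; first by rewrite size_take_min size_cat; lia.
exists (drop n u), v; split.
- by rewrite size_drop; lia.
- rewrite drop_cat; case: ltnP => // un.
  have -> : n = size u by lia.
  by rewrite subnn drop0 drop_size.
- by apply: eq_fits h => i.
Qed.

Lemma eq_in_subst (Sigma : finType) (phi psi : substitution Sigma) p :
  {in variables p, phi =1 psi} -> subst phi p = subst psi p.
Proof.
rewrite /subst; elim: p => [//|[a|x] p IH] /= h; first by rewrite IH.
congr (_ ++ _); first by apply: h; rewrite inE eqxx.
by apply: IH => y yp; apply: h; rewrite inE yp orbT.
Qed.

Lemma fits_subst (Sigma : finType) (phi : substitution Sigma) p :
  fits (terminals p) (gap (fun x => size (phi x)) p) (subst phi p).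
Proof.
elim: p => [//|[a|x] p IH] /=; first by exists [::], (subst phi p).
exact: fits_cat IH.
Qed.

(** Converse of [fits_subst]: cut each gap from left to right into pieces of lengths [l x]. No
    variable recurs in [p], so the pieces can be assigned independently; copies of [a0] serve the
    variables outside [p]. *)
Lemma fitsP (Sigma : finType) (a0 : Sigma) (l : nat -> nat) p s :
  uniq (variables p) -> fits (terminals p) (gap l p) s ->
  exists2 phi : substitution Sigma,
    forall x, size (phi x) = l x & s = subst phi p.
Proof.
elim: p s => [|[a|x] p IH] s /=.
- move=> _ /size0nil ->; exists (fun x => nseq (l x) a0) => // x.
  exact: size_nseq.
- move=> up [u [t] [/size0nil -> -> h]].
  by have [phi sphi ->] := IH _ up h; exists phi.
- move=> /andP[xp up] h.
  have [st ft] := fits_drop (g := gap l p) (n := l x) erefl (fun=> erefl) h.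
  have [phi sphi dphi] := IH _ up ft.
  exists (fun y => if y == x then take (l x) s else phi y) => [y|].
    by case: eqP => [->|].
  rewrite -[LHS](cat_take_drop (l x)) dphi /subst /= eqxx; congr (_ ++ _).
  apply: eq_in_subst => y yp; case: eqP => // yx.
  by rewrite -yx yp in xp.
Qed.

(** * Words with a unique gap vector *)

(** The filler [c] depends on the terminals to the left and right of a gap, with [None] at an end of
    the word; [o] is the left neighbour of the first gap. *)
Fixpoint separated (Sigma : finType) (c : option Sigma -> option Sigma -> Sigma)
    (o : option Sigma) (w : seq Sigma) (g : nat -> nat) : seq Sigma :=
  nseq (g 0) (c o (ohead w)) ++
  if w is a :: w' then a :: separated c (Some a) w' (fun i => g i.+1) else [::].

Lemma fits_separated (Sigma : finType) c o (w : seq Sigma) g :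
  fits w g (separated c o w g).
Proof.
elim: w o g => [|a w IH] o g /=; first by rewrite cats0 size_nseq.
by exists (nseq (g 0) (c o (Some a))), (separated c (Some a) w (fun i => g i.+1));
  split; rewrite ?size_nseq.
Qed.

Lemma nth_separated (Sigma : finType) c o (w : seq Sigma) g x0 i :
  i < g 0 -> nth x0 (separated c o w g) i = c o (ohead w).
Proof.
by move=> h; case: w => [|a w] /=; rewrite nth_cat size_nseq h nth_nseq h.
Qed.

(** A longer first gap would swallow the first terminal [a] and match [a] at a later place. By
    induction that place lies in the next gap of the word, whose filler differs from its left
    neighbour [a]. *)
Lemma fits_separated_le (Sigma : finType) c o (w : seq Sigma) g g' :
  (forall a o', c (Some a) o' != a) ->
  fits w g' (separated c o w g) -> g' 0 <= g 0.
Proof.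
move=> hc; elim: w o g g' => [|a w IH] o g g' /=.
  by rewrite cats0 size_nseq => ->.
case=> v [t] [sv es h]; rewrite leqNgt; apply/negP => lt.
(* The part of [v] that follows the swallowed terminal. *)
pose x := drop (g 0).+1 v.
have et : separated c (Some a) w (fun i => g i.+1) = x ++ a :: t.
  move/(congr1 (drop (g 0).+1)): es.
  rewrite drop_cat size_nseq ltnNge leqnSn /= subSnn /= drop0 => ->.
  rewrite drop_cat sv; case: ltnP => // h'.
  have e : (g 0).+1 = g' 0 by lia.
  by rewrite /x e subnn drop0 -sv drop_size.
(* The second occurrence of [a] is absorbed into the next gap, so that the induction hypothesis
   gives [size x < g 1]. *)
have ft : fits w (fun i => if i is 0 then size (rcons x a) + g' 1 else g' i.+1)
    (separated c (Some a) w (fun i => g i.+1)).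
  by rewrite et -cat_rcons; apply: fits_cat h.
have := IH _ _ _ ft; rewrite size_rcons => lx.
have := nth_separated c (Some a) w (g := fun i => g i.+1) a (i := size x).
rewrite et nth_cat ltnn subnn /= => e.
by have := hc a (ohead w); rewrite -e ?eqxx //; lia.
Qed.

(** The first gap cannot be shorter either: its filler would then have to match the terminal on its
    right. Equal first gaps cancel, and the argument recurs. *)
Lemma fits_separated_inj (Sigma : finType) c o (w : seq Sigma) g g' :
  (forall a o', c (Some a) o' != a) -> (forall a o', c o' (Some a) != a) ->
  fits w g' (separated c o w g) -> forall i, i <= size w -> g' i = g i.
Proof.
move=> hl hr; elim: w o g g' => [|a w IH] o g g'.
  by rewrite /= cats0 size_nseq => e [].
move=> h; have := fits_separated_le hl h.
case: h => v [t] [sv es h] le.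
have ge : g 0 <= g' 0.
  rewrite leqNgt; apply/negP => lt.
  have := nth_separated c o (a :: w) a lt.
  rewrite es nth_cat sv ltnn subnn /= => e.
  by have := hr a o; rewrite -e eqxx.
have e0 : g' 0 = g 0 by lia.
move: es => /= /eqP; rewrite eqseq_cat ?size_nseq ?sv // => /andP[_ /eqP[et]].
by rewrite -et in h; case=> [//|i]; exact: (IH _ _ _ h).
Qed.

Lemma exists_separator (Sigma : finType) : 3 <= #|Sigma| ->
  exists c : option Sigma -> option Sigma -> Sigma,
    (forall a o, c (Some a) o != a) /\ (forall a o, c o (Some a) != a).
Proof.
move=> hS.
have h (q : option Sigma * option Sigma) :
    exists c, (q.1 != Some c) && (q.2 != Some c).
  case: q => o1 o2 /=; apply/existsP; apply: contraTT hS => /existsPn h.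
  (* If every letter were excluded, each would be one of the at most two neighbours. *)
  have sub : {subset enum Sigma <= pmap id [:: o1; o2]}.
    move=> c _; have := h c; rewrite negb_and !negbK mem_pmap map_id !inE.
    by rewrite (eq_sym o1) (eq_sym o2).
  rewrite -leqNgt cardE; apply: leq_trans (uniq_leq_size (enum_uniq _) sub) _.
  by rewrite size_pmap; apply: leq_trans (count_size _ _) _.
exists (fun o1 o2 => xchoose (h (o1, o2))); split=> a o.
  by have /andP[] := xchooseP (h (Some a, o)); rewrite eq_sym.
by have /andP[_] := xchooseP (h (o, Some a)); rewrite eq_sym.
Qed.

(** * Equality of the terminal words *)

Lemma subst_nil (Sigma : finType) (p : seq (symbol Sigma)) :
  subst (fun=> [::]) p = terminals p.
Proof. by rewrite /subst; elim: p => [//|[a|x] p /= ->]. Qed.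

Lemma terminals_subseq (Sigma : finType) (phi : substitution Sigma) p :
  subseq (terminals p) (subst phi p).
Proof.
rewrite /subst; elim: p => [//|[a|x] p IH] /=; first by rewrite eqxx.
exact: subseq_trans IH (suffix_subseq _ _).
Qed.

Lemma terminals_S_eps (Sigma : finType) l (P : relational_pattern Sigma) :
  S_eps l P (terminals (pattern P)).
Proof.
exists (fun=> [::]); last by rewrite subst_nil.
case e : (variables _) => [|x v]; [by left|right].
by exists x; [rewrite inE eqxx|exists 0].
Qed.

(** Erasing all variables shows that each terminal word lies in the other language, hence has the
    other terminal word as a subsequence. *)
Lemma eq_terminals (Sigma : finType) l l' (P P' : relational_pattern Sigma) :
  S_eps l P `<=` epsL_len P' -> S_eps l' P' `<=` epsL_len P ->
  terminals (pattern P) = terminals (pattern P').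
Proof.
move=> /(_ _ (terminals_S_eps l P)) [phi _ e].
move=> /(_ _ (terminals_S_eps l' P')) [psi _ e'].
have := terminals_subseq phi (pattern P').
have := terminals_subseq psi (pattern P).
rewrite -e -e' => s1 s2; apply/eqP.
rewrite -(size_subseq_leqif s1) eqn_leq; apply/andP; split.
  exact: size_subseq s1.
exact: size_subseq s2.
Qed.

(** * Groups, consistency and finiteness *)

(** The group before restriction to the variables of the pattern: its indicator is constant along
    the relation, also outside the pattern. *)
Definition linked (Sigma : finType) (P : relational_pattern Sigma) (x y : nat) :=
  y = x \/ clos_trans nat (fun u v => relation P u v \/ relation P v u) x y.

Lemma linked_relation (Sigma : finType) (P : relational_pattern Sigma) x u v :
  relation P u v -> linked P x u <-> linked P x v.
Proof.
move=> Ruv; split; case=> [<-|h]; right.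
- by apply: t_step; left.
- by apply: t_trans h _; apply: t_step; left.
- by apply: t_step; right.
- by apply: t_trans h _; apply: t_step; right.
Qed.

Lemma linked_eq (Sigma : finType) (P : relational_pattern Sigma) (T : Type)
    (f : nat -> T) x y :
  (forall u v, relation P u v -> f u = f v) -> linked P x y -> f y = f x.
Proof.
move=> hf [->//|]; elim=> {x y} [x y [/hf|/hf]|x y z _ h1 _ h2] //.
by rewrite h2.
Qed.

Lemma S_eps_sub_epsL_len (Sigma : finType) l (P : relational_pattern Sigma) :
  S_eps l P `<=` epsL_len P.
Proof.
move=> _ [phi [v0|[x xp [z _ [hz h0]]]] ->].
  exists (fun=> [::]) => //.
  by apply: eq_in_subst => y; rewrite v0.
(* [phi] erases the variables outside the pattern, even those linked to [x]; these need length [z].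
   A letter for them is taken from [phi x], and if that word is empty then [z] is 0. *)
pose psi y := if y \in variables (pattern P) then phi y else
  if `[< linked P x y >] then (if phi x is a :: _ then nseq z a else [::])
  else [::].
exists psi; last by apply: eq_in_subst => y yp; rewrite /psi yp.
have sx : size (phi x) = z by apply: hz; split; [|left].
have sz y : size (psi y) = if `[< linked P x y >] then z else 0.
  rewrite /psi; case: ifPn => yp; case: asboolP => xy.
  - by apply: hz.
  - by rewrite h0 // => -[].
  - by case: (phi x) sx => [<-//|a s _]; rewrite size_nseq.
  - by [].
move=> u v Ruv; rewrite !sz.
by rewrite (asbool_equiv_eq (linked_relation x Ruv)).
Qed.

Lemma size_S_eps1 (Sigma : finType) (P : relational_pattern Sigma) s :
  S_eps 1 P s -> size s <= size (pattern P).
Proof.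
case=> phi h ->.
have : {in variables (pattern P), forall y, size (phi y) <= 1}.
  case: h => [->//|[x xp [z z1 [hz h0]]] y yp].
  by have [/hz ->//|/h0 ->] := pselect (group P x y).
rewrite /subst; elim: (pattern P) => [//|[a|y] p IH] /= hp.
  exact: IH.
rewrite size_cat -add1n leq_add //; first by apply: hp; rewrite inE eqxx.
by apply: IH => u up; apply: hp; rewrite inE up orbT.
Qed.

Lemma finite_S_eps1 (Sigma : finType) (P : relational_pattern Sigma) :
  finite_set (S_eps 1 P).
Proof.
pose n := size (pattern P).
apply: (@sub_finite_set _ _
  ((fun t : {i : 'I_n.+1 & i.-tuple Sigma} => tval (tagged t)) @` setT)).
  move=> s /size_S_eps1; rewrite -ltnS => sn.
  by exists (Tagged (fun i : 'I_n.+1 => i.-tuple Sigma)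
               (in_tuple s : (Ordinal sn).-tuple Sigma)).
exact/finite_image/finite_finset.
Qed.

(** * Transfer of gap vectors between patterns *)

Lemma gap_group (Sigma : finType) (P P' : relational_pattern Sigma) x :
  3 <= #|Sigma| -> terminals (pattern P) = terminals (pattern P') ->
  S_eps 1 P `<=` epsL_len P' -> x \in variables (pattern P) ->
  exists2 psi : substitution Sigma, R_substitution (relation P') psi &
    gap (fun y => `[< linked P x y >] : nat) (pattern P) =1
    gap (fun y => size (psi y)) (pattern P').
Proof.
move=> hS ew sub xp; have [c [hl hr]] := exists_separator hS.
(* [S_eps] demands emptiness outside [group], hence this indicator rather than that of [linked]; the
   two agree on the pattern. *)
pose e y : nat := `[< group P x y >].
have ee : gap (fun y => `[< linked P x y >] : nat) (pattern P) =1
          gap e (pattern P).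
  apply: eq_in_gap => y yp; congr nat_of_bool.
  by apply: asbool_equiv_eq; split=> [|[]].
have [phi sphi dphi] := fitsP (c None None) (pattern_uniq P)
  (fits_separated c None (terminals (pattern P)) (gap e (pattern P))).
have [|psi Rpsi dpsi] := sub (subst phi (pattern P)).
  exists phi => //; right; exists x => //; exists 1 => //; split=> y hy.
    by rewrite sphi /e asboolT.
  by apply/size0nil; rewrite sphi /e asboolF.
exists psi => // i; rewrite ee.
have := fits_subst psi (pattern P'); rewrite -dpsi -dphi -ew => h.
(* Uniqueness covers the gaps up to the last one; beyond it both vectors vanish. *)
case: (leqP i (size (terminals (pattern P)))) => hi.
  by rewrite (fits_separated_inj hl hr h hi).
by rewrite !gap_default // -ew.
Qed.

(** Peel off one group at a time: [l] is constant on the class of [x], so the indicator of a class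
    with [0 < l x] can be subtracted, and the total length over the pattern drops. *)
Lemma gap_transfer (Sigma : finType) (P P' : relational_pattern Sigma) l :
  3 <= #|Sigma| -> terminals (pattern P) = terminals (pattern P') ->
  S_eps 1 P `<=` epsL_len P' ->
  (forall u v, relation P u v -> l u = l v) ->
  exists2 l' : nat -> nat, forall u v, relation P' u v -> l' u = l' v &
    gap l (pattern P) =1 gap l' (pattern P').
Proof.
move=> hS ew sub; have [n] := ubnP (\sum_(x <- variables (pattern P)) l x).
elim: n l => // n IH l ltn hl.
have [/hasP[x xp lx]|/hasPn l0] :=
    boolP (has (fun x => 0 < l x) (variables (pattern P))); last first.
  exists (fun=> 0) => // i; rewrite gap0 -[RHS](gap0 (pattern P) i).
  by apply: eq_in_gap => y /l0; rewrite -eqn0Ngt => /eqP.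
pose e y : nat := `[< linked P x y >].
have el y : e y <= l y.
  by rewrite /e; case: asboolP => // xy; rewrite (linked_eq hl xy).
have [|u v Ruv|l1 hl1 gl1] := IH (fun y => l y - e y).
- move: ltn; rewrite ltnS; apply: leq_trans.
  rewrite (big_rem x xp) [X in _ < X](big_rem x xp) /= -addSn leq_add //.
    have -> : e x = 1 by rewrite /e asboolT //; left.
    by lia.
  by apply: leq_sum => y _; exact: leq_subr.
- by rewrite /e (hl _ _ Ruv) (asbool_equiv_eq (linked_relation x Ruv)).
have [psi Rpsi gpsi] := gap_group hS ew sub xp.
exists (fun y => l1 y + size (psi y)) => [u v Ruv|i].
  by rewrite (hl1 _ _ Ruv) (Rpsi _ _ Ruv).
rewrite gapD -gl1 -gpsi -gapD; apply: eq_in_gap => y _.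
by rewrite subnK // el.
Qed.

Lemma epsL_len_sub (Sigma : finType) (P P' : relational_pattern Sigma) :
  3 <= #|Sigma| -> terminals (pattern P) = terminals (pattern P') ->
  S_eps 1 P `<=` epsL_len P' -> epsL_len P `<=` epsL_len P'.
Proof.
move=> hS ew sub _ [phi Rphi ->].
have [l' hl' gl'] := gap_transfer hS ew sub Rphi.
(* This supplies a letter of [Sigma], as [fitsP] requires. *)
have [c _] := exists_separator hS.
have := eq_fits gl' (fits_subst phi (pattern P)); rewrite ew => h.
have [psi spsi ->] := fitsP (c None None) (pattern_uniq P') h.
by exists psi => // u v Ruv; rewrite !spsi (hl' _ _ Ruv).
Qed.

Theorem theorem5 (Sigma : finType) (hSigma : 3 <= #|Sigma|) :
  (forall P P' : relational_pattern Sigma,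
     S_eps 1 P `<=` epsL_len P' ->
     S_eps 1 P' `<=` epsL_len P ->
     epsL_len P = epsL_len P') /\
  positive_characteristic_sets
    (fun P : relational_pattern Sigma => epsL_len P)
    (fun P : relational_pattern Sigma => S_eps 1 P `*` [set true]).
Proof.
have main (P P' : relational_pattern Sigma) : S_eps 1 P `<=` epsL_len P' ->
    S_eps 1 P' `<=` epsL_len P -> epsL_len P = epsL_len P'.
  move=> h h'; have ew := eq_terminals h h'.
  by apply/seteqP; split; apply: epsL_len_sub.
split=> //; split=> [P|P|P P' ne [h _] [h' _]].
- split; first by apply: finite_setX; [exact: finite_S_eps1|exact: finite_set1].
  by move=> s [].
- split=> s [] //= h _; exact: S_eps_sub_epsL_len h.
- by apply: ne; apply: main => s hs; [apply: h|apply: h'].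
Qed.
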